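(* Consider the random walk with absorption on $\{0,1,\dots,N\}$, $N\ge1$, with parameters $p_i,q_i,r_i,s_i$, with $s_i>0$ for all $i=0,1,\dots,N$ and with $p_i>0$ for $i=0,\dots,N-1$. Let $m_i$ be the expected time until absorption when starting in $i$. Then, with $A_i^{(m)}=A_i^{(m)}(\omega,\phi)$, for $0\le i\le N$: $$m_i=\sum_{k=1}^{i}A_{i-k}^{(k)}\alpha_{k-1}-\frac{A_i^{(0)}\left[\omega_N\sum_{k=1}^{N}A_{N-k}^{(k)}\alpha_{k-1}+\phi_{N-1}\sum_{k=1}^{N-1}A_{N-1-k}^{(k)}\alpha_{k-1}+\alpha_N\right]}{\omega_NA_N^{(0)}+\phi_{N-1}A_{N-1}^{(0)}}.$$
   Context: Random walk: in every state $i\in\{0,1,\dots,N\}$ one has nonnegative one-step probabilities: $p_i$ (move to $i+1$), $q_i$ (move to $i-1$), $r_i$ (stay in $i$), $s_i$ (absorption in state $i$, after which the walk has ended; the absorption itself counts as one step), with $p_i+q_i+r_i+s_i=1$ for $0\le i\le N$, and $q_0=p_N=0$. $T_i$ is the time (number of steps) until absorption when starting in $i$, and $m_i=E[T_i]=\sum_{k=1}^\infty kP(T_i=k)$. Abbreviations: $$\omega_i=\frac{1-r_i}{p_i}\ (i=0,\dots,N-1),\quad \omega_N=1-r_N;$$ $$\phi_i=-\frac{q_{i+1}}{p_{i+1}}\ (i=0,\dots,N-2),\quad \phi_{N-1}=-q_N;$$ $$\alpha_i=-\frac1{p_i}\ (i=0,\dots,N-1),\quad \alpha_N=-1.$$ Fibonacci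 numbers: $f_0=f_1=1$, $f_{n+1}=f_n+f_{n-1}$ for $n\ge1$. Fibonacci matrices: fix an integer $m$ and real numbers $\omega_m,\omega_{m+1},\dots$ and $\phi_m,\phi_{m+1},\dots$ (as many as needed). Put $F_0=[1]$, $F_1=[\omega_m]$. For $n\ge 1$, $F_{n+1}$ is the matrix with $n+1$ rows and $f_{n+1}$ columns defined recursively as follows. In columns $1,\dots,f_n$: rows $1,\dots,n$ form the matrix $F_n$, and every entry of row $n+1$ is $\omega_{m+n}$. In columns $f_n+1,\dots,f_{n+1}$ (there are $f_{n-1}$ of them): rows $1,\dots,n-1$ form the matrix $F_{n-1}$ (for $n=1$ there are no such rows), every entry of row $n$ is $1$, and every entry of row $n+1$ is $\phi_{m+n-1}$. Since $F_n$ is the upper left block of $F_{n+1}$, the $(i,j)$ entry does not depend on which matrix containing that position is used; it is denoted $\tau_{ij}^{(m)}$. Notation: $A_i^{(m)}(\omega,\phi)=\sum_{j=1}^{f_i}\prod_{k=1}^{i}\tau_{kj}^{(m)}$ for $i\ge1$, $A_0^{(m)}=1$, $A_{-1}^{(m)}=0$. Empty sums are $0$. (The superscript $m$ is an integer index, unrelated to the expectations $m_i$.) *)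

(* Defs.v *)
From HB Require Import structures.
From mathcomp Require Import all_boot all_order all_algebra.
From mathcomp Require Import all_classical all_reals all_analysis.

Set Implicit Arguments.
Unset Strict Implicit.
Unset Printing Implicit Defensive.

Import Order.TTheory GRing.Theory Num.Theory.

Local Open Scope classical_set_scope.
Local Open Scope ring_scope.

(* [inl j]: the walk is in state j;
   [inr j]: the walk has ended by absorption in state j. *)
Definition walk_state (N : nat) : Type := ('I_N.+1 + 'I_N.+1)%type.

Definition absorbed (N : nat) (x : walk_state N) : Prop :=
  exists j : 'I_N.+1, x = inr j.

(* Only the values of p, q, r, s at indices 0, ..., N are used. *)
Definition step_prob (R : realType) (N : nat) (p q r s : nat -> R)
    (x y : walk_state N) : R :=
  match x, y with
  | inl i, inl j =>
      if j == i.+1 :> nat then p i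
      else if j.+1 == i :> nat then q i
      else if j == i then r i
      else 0
  | inl i, inr j => if j == i then s i else 0
  | inr _, inl _ => 0
  | inr i, inr j => if j == i then 1 else 0
  end.

(* The Markov property is stated in multiplied-out form, so that no
   conditioning on null events occurs. *)
Record absorbing_walk (R : realType) (N : nat) (p q r s : nat -> R)
    (d : measure_display) (Omega : measurableType d) (P : probability Omega R)
    (X : nat -> Omega -> walk_state N) (i : 'I_N.+1) : Prop := AbsorbingWalk {
  walk_measurable : forall n x, measurable [set w | X n w = x];
  walk_start : P [set w | X 0%N w = inl i] = 1%E;
  walk_markov : forall n (x : nat -> walk_state N),
    P [set w | forall k, (k <= n.+1)%N -> X k w = x k] =
    (P [set w | forall k, (k <= n)%N -> X k w = x k]
     * (step_prob p q r s (x n) (x n.+1))%:E)%E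
}.

(* Equal to +oo on trajectories that are never absorbed. *)
Definition absorption_time (R : realType) (N : nat) (Omega : Type)
    (X : nat -> Omega -> walk_state N) (w : Omega) : \bar R :=
  ereal_inf [set (n%:R)%:E | n in [set n : nat | absorbed (X n w)]].

Definition mean_time (R : realType) (d : measure_display)
    (Omega : measurableType d) (P : probability Omega R)
    (T : Omega -> \bar R) : \bar R :=
  (\sum_(1 <= k <oo) (k%:R)%:E * P [set w | T w = (k%:R)%:E])%E.

Definition omega (R : realType) (N : nat) (p r : nat -> R) (i : nat) : R :=
  if i == N then 1 - r N else (1 - r i) / p i.

Definition phi (R : realType) (N : nat) (p q : nat -> R) (i : nat) : R :=
  if i.+1 == N then - q N else - (q i.+1 / p i.+1).

Definition alpha (R : realType) (N : nat) (p : nat -> R) (i : nat) : R :=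
  if i == N then -1 else - (1 / p i).

Fixpoint fib (n : nat) : nat :=
  match n with
  | 0 => 1
  | n1.+1 => match n1 with 0 => 1 | n2.+1 => fib n1 + fib n2 end
  end%N.

(* The row count n.-1.+1 is 1 for n = 0 and n otherwise. Rows and columns are
   numbered from 0; [inord i] is row i of the smaller matrix. *)
Fixpoint fibmx (R : realType) (om ph : nat -> R) (m n : nat) :
    'M[R]_(n.-1.+1, fib n) :=
  match n with
  | 0 => const_mx 1
  | n1.+1 =>
    match n1 as k return 'M[R]_(k.-1.+1, fib k) -> 'M[R]_(k.+1, fib k.+1) with
    | 0 => fun=> const_mx (om m)
    | n2.+1 => fun F1 =>
      let F2 := fibmx om ph m n2 in
      row_mx
        (\matrix_(i < n2.+2, j < fib n2.+1)
           if (i < n2.+1)%N then F1 (inord i) j else om (m + n2.+1)%N)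
        (\matrix_(i < n2.+2, j < fib n2)
           if (i < n2)%N then F2 (inord i) j
           else if i == n2 :> nat then 1
           else ph (m + n2)%N)
    end (fibmx om ph m n1)
  end.

(* The entries tau_kj for k <= i and j <= f_i are read off F_i, of which every
   later F_n is an extension. *)
Definition fibA (R : realType) (om ph : nat -> R) (m i : nat) : R :=
  match i with
  | 0 => 1
  | i1.+1 => \sum_(j < fib i1.+1) \prod_(k < i1.+1) fibmx om ph m i1.+1 k j
  end.

(* Main.v *)
(* Splitting the columns of the Fibonacci matrix gives
   A_(n+2) = omega_(m+n+1) A_(n+1) + phi_(m+n) A_n, so that the right-hand side
   h of the claimed formula is the solution of the first-step equations
   h_l = 1 + p_l h_(l+1) + q_l h_(l-1) + r_l h_l; the denominator is positive
   because A^(0) is positive and nondecreasing.  Let u_n(l) = P (T > n, X_n = l).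
   Pairing u_n with the first-step equations makes the partial sums telescope:
   sum_(k <= n) k P (T = k) = h_i - sum_l u_n(l) (h_l + n).  Since every s_l is
   bounded below by some c > 0, the mass of u_n is at most (1 - c)^n, and the
   remainder tends to 0. *)
Require Import Defs.
From HB Require Import structures.
From mathcomp Require Import all_boot all_order all_algebra.
From mathcomp Require Import all_classical all_reals all_analysis.
From mathcomp Require Import ring lra zify.

Set Implicit Arguments.
Unset Strict Implicit.
Unset Printing Implicit Defensive.

Import Order.TTheory GRing.Theory Num.Theory numFieldNormedType.Exports.

Local Open Scope classical_set_scope.
Local Open Scope ring_scope.

(** * Three-term recurrences from the Fibonacci matrices *)

(** A column of F_(n+2) is a column of F_(n+1) followed by omega, or a column of F_n followed by 1
    and phi; these last entries factor out of the column products. *)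
Lemma fibAS (R : realType) (om ph : nat -> R) (m n : nat) :
  fibA om ph m n.+2 =
  om (m + n.+1)%N * fibA om ph m n.+1 + ph (m + n)%N * fibA om ph m n.
Proof.
rewrite {1}/fibA [LHS](@big_split_ord _ _ _ (fib n.+1) (fib n)) /=; congr (_ + _).
  rewrite mulr_sumr; apply: eq_bigr => j _.
  rewrite big_ord_recr /= row_mxEl mxE ltnn mulrC; congr (_ * _).
  apply: eq_bigr => k _; rewrite row_mxEl mxE /= ltn_ord.
  by congr (fun_of_matrix _ _ _); apply: val_inj; rewrite /= inordK.
(* At [n = 0] the matrix has a row but the product is empty, so its single column contributes 1, in
   agreement with the separate case of [fibA]. *)
have -> : fibA om ph m n = \sum_(j < fib n) \prod_(k < n) fibmx om ph m n (inord k) j.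
  case: n => [|n]; first by rewrite big_ord1 big_ord0.
  by apply: eq_bigr => j _; apply: eq_bigr => k _; rewrite inord_val.
rewrite mulr_sumr; apply: eq_bigr => j _.
rewrite !big_ord_recr /= !row_mxEr !mxE /= !ltnn eqxx mulr1.
rewrite ltnNge leqnSn /= eqn_leq ltnn /= mulrC; congr (_ * _).
by apply: eq_bigr => k _; rewrite row_mxEr mxE /= ltn_ord.
Qed.

Lemma fibA0 (R : realType) (om ph : nat -> R) (m : nat) : fibA om ph m 0 = 1.
Proof. by []. Qed.

Lemma fibA1 (R : realType) (om ph : nat -> R) (m : nat) :
  fibA om ph m 1 = om m.
Proof. by rewrite /fibA !big_ord1 mxE. Qed.

(** Superposition of homogeneous solutions, one started at each source [al k.-1]: the solution of
    the inhomogeneous recurrence that vanishes at 0. *)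
Definition fibB (R : realType) (om ph al : nat -> R) (n : nat) : R :=
  \sum_(1 <= k < n.+1) fibA om ph k (n - k) * al k.-1.

Lemma fibBS (R : realType) (om ph al : nat -> R) (n : nat) :
  fibB om ph al n.+2 =
  om n.+1 * fibB om ph al n.+1 + ph n * fibB om ph al n + al n.+1.
Proof.
rewrite /fibB (@big_nat_recr _ _ _ n.+2) // !(@big_nat_recr _ _ _ n.+1) //=.
rewrite !subnn subSnn fibA1 /= mul1r !mulrDr !mulr_sumr.
(* The terms [k = n.+1] and [k = n.+2], which involve only A_1 and A_0, are already split off. In
   the others, k + (n - k) = n makes the coefficients from [fibAS] independent of [k]. *)
have -> : \sum_(1 <= k < n.+1) fibA om ph k (n.+2 - k) * al k.-1 =
   \sum_(1 <= k < n.+1) om n.+1 * (fibA om ph k (n.+1 - k) * al k.-1) +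
   \sum_(1 <= k < n.+1) ph n * (fibA om ph k (n - k) * al k.-1).
  rewrite -big_split; apply: eq_big_nat => k /andP[_]; rewrite ltnS => kn /=.
  rewrite !subSn ?(leqW kn)// fibAS addnS subnKC//; ring.
rewrite mul1r; ring.
Qed.

Lemma fibB0 (R : realType) (om ph al : nat -> R) : fibB om ph al 0 = 0.
Proof. by rewrite /fibB big_geq. Qed.

Lemma fibB1 (R : realType) (om ph al : nat -> R) : fibB om ph al 1 = al 0%N.
Proof. by rewrite /fibB big_nat1 mul1r. Qed.

(** * The denominator and the first-step equations *)

(** Since 1 - r = p + q + s, each increment is a nonnegative combination of the previous increment
    and the previous term; positivity and monotonicity are therefore carried through the induction
    together. *)
Lemma fibA_walk_mono (R : realType) (N : nat) (p q r s : nat -> R)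
    (hq0 : forall i, (i <= N)%N -> 0 <= q i)
    (hsum : forall i, (i <= N)%N -> p i + q i + r i + s i = 1)
    (hq : q 0%N = 0)
    (hs : forall i, (i <= N)%N -> 0 < s i)
    (hp : forall i, (i < N)%N -> 0 < p i) n :
  (n <= N)%N ->
  0 < fibA (omega N p r) (phi N p q) 0 n /\
  ((0 < n)%N -> fibA (omega N p r) (phi N p q) 0 n.-1
                <= fibA (omega N p r) (phi N p q) 0 n).
Proof.
elim/ltn_ind: n => -[|[|n]] IH nN; first by rewrite ltr01.
  rewrite fibA1 /omega ltn_eqF// /=.
  have p0 := hp 0%N nN.
  have : 1 <= (1 - r 0%N) / p 0%N.
    rewrite ler_pdivlMr// mul1r.
    by have := hsum _ (leq0n N); have := hs _ (leq0n N); rewrite hq; lra.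
  by split=> //; lra.
have [A0 A1] := IH n.+1 (ltnSn _) (ltnW nN); have {}A1 := A1 isT.
have pn := hp _ nN; have qn := hq0 _ (ltnW nN).
have E : fibA (omega N p r) (phi N p q) 0 n.+2 -
   fibA (omega N p r) (phi N p q) 0 n.+1 =
   (q n.+1 * (fibA (omega N p r) (phi N p q) 0 n.+1 -
              fibA (omega N p r) (phi N p q) 0 n) +
    s n.+1 * fibA (omega N p r) (phi N p q) 0 n.+1) / p n.+1.
  rewrite fibAS !add0n /omega /phi !ltn_eqF//.
  have -> : r n.+1 = 1 - p n.+1 - q n.+1 - s n.+1 by rewrite -(hsum _ (ltnW nN)); ring.
  by field; rewrite gt_eqF.
have : 0 <= fibA (omega N p r) (phi N p q) 0 n.+2 -
   fibA (omega N p r) (phi N p q) 0 n.+1.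
  rewrite E divr_ge0 ?(ltW pn)// addr_ge0// mulr_ge0// ?subr_ge0//; last exact: ltW.
  exact/ltW/hs/ltnW.
by rewrite subr_ge0 => le12; split=> [|_ //]; exact: lt_le_trans le12.
Qed.

(** As 1 - r_N = q_N + s_N, the expression equals q_N (A_N - A_(N-1)) + s_N A_N, a nonnegative term
    plus a positive one. *)
Lemma fibA_walk_det_gt0 (R : realType) (N : nat) (p q r s : nat -> R)
    (hq0 : forall i, (i <= N)%N -> 0 <= q i)
    (hsum : forall i, (i <= N)%N -> p i + q i + r i + s i = 1)
    (hq : q 0%N = 0) (hpN : p N = 0)
    (hs : forall i, (i <= N)%N -> 0 < s i)
    (hp : forall i, (i < N)%N -> 0 < p i) :
  (0 < N)%N ->
  0 < omega N p r N * fibA (omega N p r) (phi N p q) 0 N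
      + phi N p q N.-1 * fibA (omega N p r) (phi N p q) 0 N.-1.
Proof.
move=> N0; have [A0 /(_ N0)] := fibA_walk_mono hq0 hsum hq hs hp (leqnn N).
set a := fibA _ _ _ N in A0 *; set b := fibA _ _ _ _ => ba.
rewrite /omega /phi prednK// eqxx.
have -> : 1 - r N = q N + s N by rewrite -(hsum _ (leqnn N)) hpN; ring.
have := mulr_gt0 (hs _ (leqnn N)) A0.
have : 0 <= q N * (a - b) by rewrite mulr_ge0 ?hq0// subr_ge0.
lra.
Qed.

(* The right-hand side of the theorem. *)
Definition walk_mean (R : realType) (N : nat) (p q r : nat -> R) (n : nat) : R :=
  let A := fibA (omega N p r) (phi N p q) in
  let B := fibB (omega N p r) (phi N p q) (alpha N p) in
  let w := omega N p r in
  let f := phi N p q in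
  B n - A 0%N n * (w N * B N + f N.-1 * B N.-1 + alpha N p N)
        / (w N * A 0%N N + f N.-1 * A 0%N N.-1).

(** Below [N], [fibB] solves the inhomogeneous equations and [fibA] the homogeneous ones, so every
    [fibB + t * fibA] is a solution there; the equation at [N] forces t = - S / D. *)
Lemma walk_mean_step (R : realType) (N : nat) (p q r s : nat -> R)
    (hq0 : forall i, (i <= N)%N -> 0 <= q i)
    (hsum : forall i, (i <= N)%N -> p i + q i + r i + s i = 1)
    (hq : q 0%N = 0) (hpN : p N = 0)
    (hs : forall i, (i <= N)%N -> 0 < s i)
    (hp : forall i, (i < N)%N -> 0 < p i) (n : nat) :
  (0 < N)%N -> (n <= N)%N ->
  walk_mean N p q r n =
  1 + (p n * walk_mean N p q r n.+1 + q n * walk_mean N p q r n.-1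
       + r n * walk_mean N p q r n).
Proof.
move=> N0 nN.
have := fibA_walk_det_gt0 hq0 hsum hq hpN hs hp N0.
set D := (X in 0 < X) => D0.
pose S := omega N p r N * fibB (omega N p r) (phi N p q) (alpha N p) N
  + phi N p q N.-1 * fibB (omega N p r) (phi N p q) (alpha N p) N.-1
  + alpha N p N.
have E k : walk_mean N p q r k = fibB (omega N p r) (phi N p q) (alpha N p) k
  - fibA (omega N p r) (phi N p q) 0 k * S / D by [].
rewrite !{}E.
have := gt_eqF D0; move: nN; rewrite leq_eqVlt => /predU1P[->{n}|nN] Dn0.
  rewrite hpN mul0r add0r.
  apply/eqP; rewrite -subr_eq0; apply/eqP.
  set a := fibA _ _ _ N; set b := fibA _ _ _ _.
  set BN := fibB _ _ _ N; set BP := fibB _ _ _ _.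
  (* The equation at [N] has defect S on [fibB], and its homogeneous part takes the value D on
     [fibA]; with the factor S / D the two cancel. *)
  have -> : BN - a * S / D -
    (1 + (q N * (BP - b * S / D) + r N * (BN - a * S / D))) =
    (((1 - r N) * BN - q N * BP - 1) * D
      - ((1 - r N) * a - q N * b) * S) / D by field; rewrite Dn0.
  have -> : (1 - r N) * BN - q N * BP - 1 = S.
    by rewrite /S /omega /phi /alpha prednK// eqxx -/BN -/BP; ring.
  have -> : (1 - r N) * a - q N * b = D.
    by rewrite /D /omega /phi prednK// eqxx -/a -/b; ring.
  by rewrite (mulrC D) subrr mul0r.
have pn := hp _ nN; have pn0 := gt_eqF pn.
case: n nN pn pn0 => [|n] nN pn pn0.
  rewrite fibA0 fibA1 fibB1 fibB0 hq [omega _ _ _ 0]/omega [alpha _ _ 0]/alpha !ltn_eqF//.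
  by field; rewrite pn0 Dn0.
rewrite fibAS fibBS add0n succnK [omega N p r n.+1]/omega [alpha N p n.+1]/alpha.
rewrite [phi N p q n]/phi !ltn_eqF//.
by field; rewrite pn0 Dn0.
Qed.

(** At the ends, [H l.+1] lies outside the state range and [H l.-1] is truncated to [H 0]; the
    weights p_N = 0 and q_0 = 0 remove these terms. *)
Lemma sum_step_prob (R : realType) (N : nat) (p q r s : nat -> R)
    (hq : q 0%N = 0) (hpN : p N = 0) (H : nat -> R) (l : 'I_N.+1) :
  \sum_(j < N.+1) step_prob p q r s (inl l) (inl j) * H j =
  p l * H l.+1 + q l * H l.-1 + r l * H l.
Proof.
transitivity (\sum_(j < N.+1) ((if j == l.+1 :> nat then p l * H l.+1 else 0) +
    (if j == l.-1 :> nat then q l * H l.-1 else 0) +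
    (if j == l then r l * H l else 0))).
  apply: eq_bigr => j _ /=; case: (eqVneq (j : nat) l.+1) => [jE|jl].
    have -> : (j == l) = false.
      by apply/eqP => /(congr1 val) /= jl; move: jE; rewrite jl => /n_Sn.
    have -> : (j == l.-1 :> nat) = false by apply/eqP; lia.
    by rewrite jE !addr0.
  rewrite add0r; case: (eqVneq (j.+1 : nat) l) => [jE|jl'].
    rewrite -[l.-1]/((l : nat).-1) -jE /= eqxx.
    have -> : (j == l) = false.
      by apply/eqP => /(congr1 val) /= jl2; move: jE; rewrite jl2; lia.
    by rewrite addr0.
  case: eqVneq => [->|jl2].
    by case: eqVneq => [l0|]; rewrite ?add0r// -l0 (_ : l = 0 :> nat)%N ?hq ?mul0r ?add0r//; lia.
  rewrite mul0r addr0; case: eqVneq => // jE.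
  have l0 : l = 0%N :> nat by move: jl2; rewrite -val_eqE /=; lia.
  by rewrite l0 hq mul0r.
rewrite !big_split /= -!big_mkcond /= big_pred1_eq; congr (_ + _ + _).
  case: (ltnP l N) => lN.
    by rewrite (big_pred1 (Ordinal (lN : (l.+1 < N.+1)%N)))//.
  have -> : l = N :> nat by apply/eqP; rewrite eqn_leq lN -ltnS ltn_ord.
  by rewrite hpN mul0r big1.
have lN : (l.-1 < N.+1)%N by exact: leq_ltn_trans (leq_pred _) (ltn_ord l).
by rewrite (big_pred1 (Ordinal lN)).
Qed.

(** * Trajectory events and the Markov property *)

(** Interpolates between the fully prescribed path of [walk_markov] ([a = 0]) and survival before
    time [n] with only the state at [n] prescribed ([a = n]). *)
Definition walk_event (N : nat) (Omega : Type) (X : nat -> Omega -> walk_state N)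
    (n a : nat) (x : nat -> walk_state N) : set Omega :=
  [set w | (forall k, (k < a)%N -> ~ absorbed (X k w)) /\
           (forall k, (a <= k <= n)%N -> X k w = x k)].

Lemma not_absorbed (N : nat) (x : walk_state N) :
  ~ absorbed x -> exists j, x = inl j.
Proof. by case: x => [j _|j []]; exists j. Qed.

Lemma ord_partition (R : realType) (d : measure_display)
    (Omega : measurableType d) (P : probability Omega R) (n : nat)
    (A : set Omega) (F : 'I_n.+1 -> set Omega) :
  (forall j, measurable (F j)) -> (forall w, A w <-> exists j, F j w) ->
  (forall j k w, F j w -> F k w -> j = k) ->
  measurable A /\ P A = (\sum_(j < n.+1) P (F j))%E.
Proof.
move=> mF AF Fdis.
have -> : A = \big[setU/set0]_(j < n.+1) F j.
  rewrite -bigcup_mkord_ord; apply/seteqP; split=> w.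
    by move=> /AF[j Fj]; exists j => /=; rewrite ?inord_val ?ltn_ord.
  by move=> [k _ Fk]; apply/AF; exists (inord k).
split; first exact: bigsetU_measurable.
by apply: measure_bigsetU_ord => // j k _ _ [w [Fj Fk]]; exact: Fdis Fj Fk.
Qed.

(** Not being absorbed at time [a] means occupying some [inl j], so prescribing that position lowers
    the threshold by one. *)
Lemma walk_event_split (N : nat) (Omega : Type) (X : nat -> Omega -> walk_state N)
    (n a : nat) (x : nat -> walk_state N) (w : Omega) : (a <= n)%N ->
  walk_event X n a.+1 x w <->
  exists j, walk_event X n a (fun k => if k == a then inl j else x k) w.
Proof.
move=> an; split=> [[Xin Xx]|[j [Xin Xx]]].
  have [j Xj] := not_absorbed (Xin _ (ltnSn a)); exists j.
  split=> k ka; first exact/Xin/ltnW.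
  by case: eqVneq => [->//|ka']; apply: Xx; lia.
split=> k ka; last first.
  by rewrite Xx; [rewrite gtn_eqF//; lia | lia].
have [->|ka'] := eqVneq k a; last by apply: Xin; lia.
by rewrite Xx ?leqnn// eqxx => -[].
Qed.

Lemma walk_event_disjoint (N : nat) (Omega : Type)
    (X : nat -> Omega -> walk_state N) (n a : nat) (x : nat -> walk_state N)
    (j k : 'I_N.+1) (w : Omega) : (a <= n)%N ->
  walk_event X n a (fun k => if k == a then inl j else x k) w ->
  walk_event X n a (fun l => if l == a then inl k else x l) w -> j = k.
Proof.
move=> an [_ Xj] [_ Xk].
have aan : (a <= a <= n)%N by rewrite leqnn.
by have := Xj a aan; rewrite (Xk a aan) eqxx => -[->].
Qed.

Lemma measurable_walk_event (R : realType) (N : nat) (p q r s : nat -> R)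
    (d : measure_display) (Omega : measurableType d) (P : probability Omega R)
    (X : nat -> Omega -> walk_state N) (i : 'I_N.+1)
    (hX : absorbing_walk p q r s P X i) (n a : nat) (x : nat -> walk_state N) :
  (a <= n.+1)%N -> measurable (walk_event X n a x).
Proof.
elim: a x => [|a IH] x an.
  rewrite (_ : walk_event X n 0 x =
    \bigcap_(k in [set k | (k <= n)%N]) [set w | X k w = x k]).
    by apply: bigcap_measurableType => k _; exact: (walk_measurable hX).
  by apply/seteqP; split=> w => [[_ Xx] k /=|Xx]; [exact: Xx|split].
apply: (ord_partition P (fun j => IH _ (ltnW an)) _ _).1 => [w|j k w].
  exact: walk_event_split.
exact: walk_event_disjoint.
Qed.

Lemma probability_walk_event (R : realType) (N : nat) (p q r s : nat -> R)
    (d : measure_display) (Omega : measurableType d) (P : probability Omega R)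
    (X : nat -> Omega -> walk_state N) (i : 'I_N.+1)
    (hX : absorbing_walk p q r s P X i) (n a : nat) (x : nat -> walk_state N) :
  (a <= n)%N ->
  P (walk_event X n a.+1 x) =
  (\sum_(j < N.+1)
     P (walk_event X n a (fun k => if k == a then inl j else x k)))%E.
Proof.
move=> an; apply: (ord_partition P _ _ _).2 => [j|w|j k w].
- exact/(measurable_walk_event hX)/leqW.
- exact: walk_event_split.
- exact: walk_event_disjoint.
Qed.

(* Forgetting the exact position at the times k < a, one time at a time,
   preserves the Markov property. *)
Lemma walk_event_markov (R : realType) (N : nat) (p q r s : nat -> R)
    (d : measure_display) (Omega : measurableType d) (P : probability Omega R)
    (X : nat -> Omega -> walk_state N) (i : 'I_N.+1)
    (hX : absorbing_walk p q r s P X i) (n a : nat) (x : nat -> walk_state N) :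
  (a <= n)%N ->
  P (walk_event X n.+1 a x) =
  (P (walk_event X n a x) * (step_prob p q r s (x n) (x n.+1))%:E)%E.
Proof.
elim: a x => [|a IH] x an.
  have E k : walk_event X k 0 x = [set w | forall l, (l <= k)%N -> X l w = x l].
    by apply/seteqP; split=> w => [[_ Xx] l /=|Xx]; [exact: Xx|split].
  by rewrite !E (walk_markov hX).
rewrite !(probability_walk_event hX) ?(ltnW an)//; last exact/leqW/ltnW.
rewrite ge0_sume_distrl//; apply: eq_bigr => j _.
(* The path is altered only at a time [a < n], so the transition factor is the same for every
   [j]. *)
by rewrite IH ?(ltnW an)// !gtn_eqF// ltnW.
Qed.

(* [P (T > n, X_n = l)], where [T] is the absorption time *)
Definition alive_prob (R : realType) (N : nat) (d : measure_display)
    (Omega : measurableType d) (P : probability Omega R)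
    (X : nat -> Omega -> walk_state N) (n : nat) (l : 'I_N.+1) : R :=
  fine (P (walk_event X n n (fun=> inl l))).

(** The target [y] is left general: live targets give the evolution of [alive_prob], absorbed ones
    the law of the absorption time. *)
Lemma probability_first_step (R : realType) (N : nat) (p q r s : nat -> R)
    (d : measure_display) (Omega : measurableType d) (P : probability Omega R)
    (X : nat -> Omega -> walk_state N) (i : 'I_N.+1)
    (hX : absorbing_walk p q r s P X i) (n : nat) (y : walk_state N) :
  P (walk_event X n.+1 n.+1 (fun=> y)) =
  (\sum_(l < N.+1) alive_prob P X n l * step_prob p q r s (inl l) y)%:E.
Proof.
rewrite (probability_walk_event hX)// -sumEFin; apply: eq_bigr => l _.
rewrite (walk_event_markov hX)// eqxx gtn_eqF// EFinM fineK; last first.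
  by apply: fin_num_measure; exact: (measurable_walk_event hX).
(* Only time [n] is prescribed in this event, so the altered path can be replaced by a constant
   one. *)
congr (P _ * _)%E; apply/seteqP; split=> w [Xin Xx]; split=> // k kn;
  rewrite Xx//; have -> : k = n by lia.
  by rewrite eqxx.
by rewrite eqxx.
Qed.

Lemma alive_probS (R : realType) (N : nat) (p q r s : nat -> R)
    (d : measure_display) (Omega : measurableType d) (P : probability Omega R)
    (X : nat -> Omega -> walk_state N) (i : 'I_N.+1)
    (hX : absorbing_walk p q r s P X i) (n : nat) (j : 'I_N.+1) :
  alive_prob P X n.+1 j =
  \sum_(l < N.+1) alive_prob P X n l * step_prob p q r s (inl l) (inl j).
Proof. by rewrite {1}/alive_prob (probability_first_step hX). Qed.

Lemma alive_prob0 (R : realType) (N : nat) (p q r s : nat -> R)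
    (d : measure_display) (Omega : measurableType d) (P : probability Omega R)
    (X : nat -> Omega -> walk_state N) (i : 'I_N.+1)
    (hX : absorbing_walk p q r s P X i) (j : 'I_N.+1) :
  alive_prob P X 0 j = (j == i)%:R.
Proof.
have E l : walk_event X 0 0 (fun=> inl l) = [set w | X 0%N w = inl l].
  apply/seteqP; split=> w /= => [[_ ->]//|X0]; split=> // k.
  by rewrite leqn0 => /eqP ->.
rewrite /alive_prob E; case: eqVneq => [->|ji]; first by rewrite (walk_start hX).
have mX x : measurable [set w | X 0%N w = x] by exact: (walk_measurable hX).
(* Any other starting state lies in the complement of an event of probability 1. *)
have P0 : P (~` [set w | X 0%N w = inl i]) = 0%E.
  by rewrite probability_setC// (walk_start hX) subee.
rewrite (subset_measure0 _ _ _ P0)//; first exact: measurableC.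
by move=> w /= -> []; apply/eqP.
Qed.

(** * Law of the absorption time *)

Lemma absorption_timeE (R : realType) (N : nat) (Omega : Type)
    (X : nat -> Omega -> walk_state N) (w : Omega) (k : nat) :
  absorption_time R X w = (k%:R)%:E <->
  absorbed (X k w) /\ forall j, (j < k)%N -> ~ absorbed (X j w).
Proof.
have first m : absorbed (X m w) -> (forall j, (j < m)%N -> ~ absorbed (X j w)) ->
    absorption_time R X w = (m%:R)%:E.
  move=> Xm Xj; apply/eqP; rewrite eq_le; apply/andP; split.
    by apply: ereal_inf_lbound; exists m.
  apply: le_ereal_inf_tmp => _ [n Xn <-]; rewrite lee_fin ler_nat leqNgt.
  by apply/negP => /Xj.
split=> [Tk|[]]; last exact: first.
(* Without absorption the infimum is over the empty set, hence [+oo], which no finite [k] equals;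
   otherwise it is attained at the least absorption index. *)
have [|noX] := pselect (exists n, `[< absorbed (X n w) >]); last first.
  move: Tk; rewrite /absorption_time.
  have -> : [set n | absorbed (X n w)] = set0.
    by apply/seteqP; split=> // n Xn; apply: noX; exists n; exact/asboolP.
  by rewrite image_set0 ereal_inf0.
move=> /ex_minnP[m /asboolP Xm minm].
have Xj j : (j < m)%N -> ~ absorbed (X j w).
  by rewrite ltnNge => + Xj; move=> /negP; apply; apply/minm/asboolP.
by move: Tk; rewrite (first _ Xm Xj) => -[/eqP]; rewrite eqr_nat => /eqP <-.
Qed.

Lemma probability_absorption_time (R : realType) (N : nat) (p q r s : nat -> R)
    (d : measure_display) (Omega : measurableType d) (P : probability Omega R)
    (X : nat -> Omega -> walk_state N) (i : 'I_N.+1)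
    (hX : absorbing_walk p q r s P X i) (n : nat) :
  P [set w | absorption_time R X w = (n.+1%:R)%:E] =
  (\sum_(l < N.+1) alive_prob P X n l * s l)%:E.
Proof.
have [|w||_ ->] := @ord_partition _ _ _ P N
    [set w | absorption_time R X w = (n.+1%:R)%:E]
    (fun j => walk_event X n.+1 n.+1 (fun=> inr j)).
- by move=> j; exact: (measurable_walk_event hX).
- split=> [/absorption_timeE[[j Xj] Xin]|[j [Xin Xj]]].
    by exists j; split=> // k kn; have -> : k = n.+1 by lia.
  by apply/absorption_timeE; split=> //; exists j; apply: Xj; rewrite leqnn.
- move=> j k w [_ Xj] [_ Xk].
  have nn : (n.+1 <= n.+1 <= n.+1)%N by rewrite leqnn.
  by have := Xj _ nn; rewrite (Xk _ nn) => -[->].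
rewrite (eq_bigr _ (fun j _ => probability_first_step hX n (inr j))) sumEFin.
(* Absorption happens in place, so for each [l] the sum over absorbed targets reduces to [s l]. *)
rewrite exchange_big; congr (_%:E); apply: eq_bigr => l _.
rewrite -mulr_sumr; congr (_ * _) => /=.
by rewrite -big_mkcond big_pred1_eq.
Qed.

(** * Telescoping and passage to the limit *)

Lemma cvg_natrM_geometric (R : realType) (c rho : R) : 0 <= rho < 1 ->
  (fun n => (c + n%:R) * rho ^+ n) @ \oo --> (0 : R).
Proof.
move=> /andP[rho0 rho1].
(* Half the gap to 1, so that [rho + e] is still below 1 and dominates the linear factor
   geometrically. *)
pose e := (1 - rho) / 2; have e0 : 0 < e by rewrite /e; lra.
(* Bernoulli's inequality for (1 + e / rho)^n, multiplied by rho^n *)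
have bern n : n%:R * rho ^+ n * e <= (rho + e) ^+ n.
  suff : (1 + n%:R * e) * rho ^+ n <= (rho + e) ^+ n.
    by have := exprn_ge0 n rho0; lra.
  elim: n => [|n IH]; first by rewrite !expr0 mul0r addr0 mul1r.
  rewrite [leRHS]exprS; apply: le_trans (ler_wpM2l _ IH); last lra.
  have x0 := exprn_ge0 n rho0; rewrite exprS -natr1 -subr_ge0.
  have -> : (rho + e) * ((1 + n%:R * e) * rho ^+ n)
    - (1 + (n%:R + 1) * e) * (rho * rho ^+ n)
    = e * rho ^+ n * (1 - rho + n%:R * e) by ring.
  have ne0 : 0 <= n%:R * e by rewrite mulr_ge0// ltW.
  by rewrite !mulr_ge0 ?(ltW e0)//; lra.
rewrite -[X in _ --> X](addr0 0); under eq_cvg do rewrite mulrDl.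
apply: cvgD; first by apply: cvg_geometric; rewrite ger0_norm.
apply: (@squeeze_cvgr _ _ _ _ (fun=> 0) (geometric e^-1 (rho + e))).
- apply: nearW => n /=; rewrite mulr_ge0 ?exprn_ge0//=.
  by rewrite ler_pdivlMl// mulrC.
- exact: cvg_cst.
- by apply: cvg_geometric; rewrite ger0_norm /e; lra.
Qed.

Lemma uniform_lower_bound (R : realType) (N : nat) (s : nat -> R) :
  (forall i, (i <= N)%N -> 0 < s i) ->
  exists2 c, 0 < c & forall i, (i <= N)%N -> c <= s i.
Proof.
elim: N => [|N IH] hs.
  by exists (s 0%N) => [|i]; [exact: hs|rewrite leqn0 => /eqP->].
have [i iN|c c0 cs] := IH; first exact/hs/leqW.
exists (Num.min c (s N.+1)) => [|i]; first by rewrite lt_min c0 hs.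
rewrite leq_eqVlt => /predU1P[->|iN]; first by rewrite ge_min lexx orbT.
by rewrite ge_min cs.
Qed.

(** If [h] is read as the mean remaining time, [h l + n] is the mean total time of a walk alive in
    [l] at time [n]; the subtracted sum is the share of the mean not yet absorbed. *)
Lemma killed_sum_time (R : realType) (N : nat) (p q r s h : nat -> R)
    (u : nat -> 'I_N.+1 -> R) (i : 'I_N.+1)
    (hsum : forall i, (i <= N)%N -> p i + q i + r i + s i = 1)
    (hq : q 0%N = 0) (hpN : p N = 0)
    (hh : forall n, (n <= N)%N ->
      h n = 1 + (p n * h n.+1 + q n * h n.-1 + r n * h n))
    (u0 : forall j, u 0%N j = (j == i)%:R)
    (uS : forall n j, u n.+1 j =
      \sum_(l < N.+1) u n l * step_prob p q r s (inl l) (inl j)) n :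
  \sum_(1 <= k < n.+1) k%:R * (\sum_(l < N.+1) u k.-1 l * s l) =
  h i - \sum_(l < N.+1) u n l * (h l + n%:R).
Proof.
(* Duality: evolving the mass [u] forward amounts to applying the transition kernel to the test
   function. *)
have uH H m : \sum_(j < N.+1) u m.+1 j * H (j : nat) =
    \sum_(l < N.+1) u m l * (p l * H l.+1 + q l * H l.-1 + r l * H l).
  under eq_bigr do rewrite uS mulr_suml.
  rewrite exchange_big; apply: eq_bigr => l _.
  under eq_bigr do rewrite -mulrA.
  by rewrite -mulr_sumr sum_step_prob.
elim: n => [|n IH].
  rewrite big_geq// (bigD1 i)//= u0 eqxx mul1r addr0 big1 ?addr0 ?subrr// => l li.
  by rewrite u0 (negbTE li) mul0r.
(* One kernel step turns h + (n+1) into h_l - 1 + (n+1)(1 - s_l) = h_l + n - (n+1) s_l, and the new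
   summand compensates the last term. *)
rewrite big_nat_recr//= IH (uH (fun l => h l + n.+1%:R)).
rewrite mulr_sumr -addrA; congr (_ + _); rewrite -!sumrN -big_split /=.
apply: eq_bigr => l _; have lN : (l <= N)%N by rewrite -ltnS.
rewrite {1}(hh _ lN) -natr1.
have -> : s l = 1 - p l - q l - r l by rewrite -(hsum _ lN); ring.
ring.
Qed.

(** From state [l] a step keeps the fraction p_l + q_l + r_l = 1 - s_l of the mass, which is at most
    1 - c; it is computed by [sum_step_prob] with the constant function 1. *)
Lemma killed_mass_bound (R : realType) (N : nat) (p q r s : nat -> R)
    (u : nat -> 'I_N.+1 -> R) (i : 'I_N.+1) (c : R)
    (hsum : forall i, (i <= N)%N -> p i + q i + r i + s i = 1)
    (hq : q 0%N = 0) (hpN : p N = 0) (c1 : c <= 1)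
    (cs : forall i, (i <= N)%N -> c <= s i)
    (u_ge0 : forall n j, 0 <= u n j)
    (u0 : forall j, u 0%N j = (j == i)%:R)
    (uS : forall n j, u n.+1 j =
      \sum_(l < N.+1) u n l * step_prob p q r s (inl l) (inl j)) n :
  \sum_(l < N.+1) u n l <= (1 - c) ^+ n.
Proof.
elim: n => [|n IH].
  rewrite (bigD1 i)//= u0 eqxx big1 ?addr0 ?expr0// => l li.
  by rewrite u0 (negbTE li).
rewrite exprS; apply: le_trans (ler_wpM2l _ IH); last by rewrite subr_ge0.
under eq_bigr do rewrite uS.
rewrite exchange_big mulr_sumr; apply: ler_sum => l _.
rewrite -mulr_sumr mulrC ler_wpM2r//.
have lN : (l <= N)%N by rewrite -ltnS.
have := sum_step_prob r s hq hpN (fun=> 1) l; rewrite !mulr1.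
under eq_bigr do rewrite mulr1.
by move=> ->; have := hsum _ lN; have := cs _ lN; lra.
Qed.

Lemma killed_sum_time_cvg (R : realType) (N : nat) (p q r s h : nat -> R)
    (u : nat -> 'I_N.+1 -> R) (i : 'I_N.+1)
    (hp0 : forall i, (i <= N)%N -> 0 <= p i)
    (hq0 : forall i, (i <= N)%N -> 0 <= q i)
    (hr0 : forall i, (i <= N)%N -> 0 <= r i)
    (hsum : forall i, (i <= N)%N -> p i + q i + r i + s i = 1)
    (hq : q 0%N = 0) (hpN : p N = 0)
    (hs : forall i, (i <= N)%N -> 0 < s i)
    (hh : forall n, (n <= N)%N ->
      h n = 1 + (p n * h n.+1 + q n * h n.-1 + r n * h n))
    (u_ge0 : forall n j, 0 <= u n j)
    (u0 : forall j, u 0%N j = (j == i)%:R)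
    (uS : forall n j, u n.+1 j =
      \sum_(l < N.+1) u n l * step_prob p q r s (inl l) (inl j)) :
  (fun n => \sum_(1 <= k < n) k%:R * (\sum_(l < N.+1) u k.-1 l * s l)) @ \oo
    --> h i.
Proof.
have [c c0 cs] := uniform_lower_bound hs.
have c1 : c <= 1.
  have := hsum _ (leqnn N); have := hp0 _ (leqnn N); have := hq0 _ (leqnn N).
  by have := hr0 _ (leqnn N); have := cs _ (leqnn N); lra.
have mass := killed_mass_bound hsum hq hpN c1 cs u_ge0 u0 uS.
(* The partial sums stop before [n], whereas the telescoped identity includes [n]; a shift of the
   index reconciles them. *)
suff : (fun n => h i - \sum_(l < N.+1) u n l * (h l + n%:R)) @ \oo --> h i - 0.
  rewrite subr0 -[X in _ -> X]cvg_shiftS; apply: cvg_trans; apply: near_eq_cvg.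
  apply: nearW => n /=; exact/esym/(killed_sum_time hsum hq hpN hh u0 uS).
apply: cvgB; first exact: cvg_cst.
(* A bound for all |h_l| at once, so that the remainder is at most (M + n) (1 - c)^n. *)
pose M := \sum_(l < N.+1) `|h l|.
have hM (l : 'I_N.+1) : `|h l| <= M by rewrite /M (bigD1 l)//= lerDl sumr_ge0.
apply/norm_cvg0P.
apply: (@squeeze_cvgr _ _ _ _ (fun=> 0) (fun n => (M + n%:R) * (1 - c) ^+ n)).
- apply: nearW => n /=; rewrite normr_ge0 /=.
  apply: le_trans (ler_norm_sum _ _ _) _.
  apply: (@le_trans _ _ (\sum_(l < N.+1) (M + n%:R) * u n l)).
    apply: ler_sum => l _; rewrite normrM ger0_norm// mulrC ler_wpM2r//.
    by rewrite (le_trans (ler_normD _ _))// lerD// ger0_norm.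
  rewrite -mulr_sumr ler_wpM2l// addr_ge0// sumr_ge0//.
- exact: cvg_cst.
- by apply: cvg_natrM_geometric; lra.
Qed.

Theorem theorem4p2 (R : realType) (N : nat) (hN : (1 <= N)%N)
    (p q r s : nat -> R)
    (hp0 : forall i, (i <= N)%N -> 0 <= p i)
    (hq0 : forall i, (i <= N)%N -> 0 <= q i)
    (hr0 : forall i, (i <= N)%N -> 0 <= r i)
    (hsum : forall i, (i <= N)%N -> p i + q i + r i + s i = 1)
    (hq : q 0%N = 0) (hpN : p N = 0)
    (hs : forall i, (i <= N)%N -> 0 < s i)
    (hp : forall i, (i < N)%N -> 0 < p i)
    (d : measure_display) (Omega : measurableType d)
    (P : probability Omega R)
    (i : 'I_N.+1) (X : nat -> Omega -> walk_state N)
    (hX : absorbing_walk p q r s P X i) :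
  let A := fibA (omega N p r) (phi N p q) in
  let w := omega N p r in
  let f := phi N p q in
  let a := alpha N p in
  mean_time P (absorption_time R X) =
  (\sum_(1 <= k < i.+1) A k (i - k)%N * a k.-1
   - A 0%N i
     * (w N * (\sum_(1 <= k < N.+1) A k (N - k)%N * a k.-1)
        + f N.-1 * (\sum_(1 <= k < N) A k (N.-1 - k)%N * a k.-1)
        + a N)
     / (w N * A 0%N N + f N.-1 * A 0%N N.-1))%:E.
Proof.
move=> A w f a.
transitivity (walk_mean N p q r i)%:E; last first.
  by rewrite /walk_mean /fibB (prednK hN).
apply: cvg_lim => //.
rewrite (_ : (fun n => _) = EFin \o (fun n => \sum_(1 <= k < n) k%:R *
    (\sum_(l < N.+1) alive_prob P X k.-1 l * s l))).
  apply: cvg_EFin; first by apply: nearW.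
  apply: (killed_sum_time_cvg hp0 hq0 hr0 hsum hq hpN hs).
  - by move=> n; exact: (walk_mean_step hq0 hsum hq hpN hs hp hN).
  - by move=> n j; exact/fine_ge0/measure_ge0.
  - exact: alive_prob0 hX.
  - exact: alive_probS hX.
(* Summation starts at 1, so each index is a successor, as the law of the absorption time
   requires. *)
apply/funext => n /=; rewrite -sumEFin; apply: eq_big_nat => -[//|k] _.
by rewrite (probability_absorption_time hX) -EFinM.
Qed.
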